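(* Let $\lambda\in(0,1)$ and let $G$ be a finite simple connected graph with $n\ge 3$ vertices. Then $$\min_{2\le D\le n-1}\frac{\lambda^{D}+\frac{1}{n-D}\cdot\frac{\lambda^{D}-\lambda}{\lambda-1}}{D\lambda^{D}+\frac{1}{n-D}\cdot\frac{\lambda-D\lambda^{D}+(D-1)\lambda^{D+1}}{(\lambda-1)^2}}\;\le\; mN^{e}_{\lambda}(G)\;\le\;1.$$ The lower bound is attained for a broom on $n$ vertices (at its starting vertex), and the upper bound is attained for every vertex-transitive graph.
   Context: $d(u,v)$ denotes graph distance and $[u]$ the set of neighbours of $u$. $t^{e}_{\lambda}(u)=\sum_{v\in V\setminus\{u\}} d(u,v)\lambda^{d(u,v)}$. For vertices $k,l$, $s^{kl}$ is the number of shortest $k$–$l$ paths and, for an edge $uv$, $s^{kl}_{uv}$ is the number of those passing through the edge $uv$. The exponential edge betweenness of an edge $uv$ is $b^{e}_{\lambda}(uv)=\sum_{\{k,l\}}\frac{s^{kl}_{uv}}{s^{kl}}\lambda^{d(k,l)}$ over all unordered pairs $\{k,l\}$ of distinct vertices; $c^{e}_{\lambda}(u)=\sum_{v\in[u]}b^{e}_{\lambda}(uv)$. The networkness of $u$ is $N^{e}_{\lambda}(u)=c^{e}_{\lambda}(u)/t^{e}_{\lambda}(u)$ and $mN^{e}_{\lambda}(G)=\min\{N^{e}_{\lambda}(u):u\in V(G)\}$. A broom on $n$ vertices (with parameter $D$, $1\le D\le n-1$) is the graph consisting of a path $u=v_0v_1\cdots v_D$ together with $n-D-1$ further vertices each adjacent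 only to $v_{D-1}$; $u=v_0$ is its starting vertex. *)

(* Defs.v *)
From HB Require Import structures.
From mathcomp Require Import all_boot all_order all_algebra perm.
Set Implicit Arguments. Unset Strict Implicit. Unset Printing Implicit Defensive.
Import Order.TTheory GRing.Theory Num.Theory.

Section Graph.
Variables (T : finType) (e : rel T).

Definition simple_graph := symmetric e /\ irreflexive e.
Definition connected_graph := forall u v : T, connect e u v.

Definition walk_of_len (u v : T) (k : nat) : bool :=
  [exists p : k.-tuple T, path e u p && (last u p == v)].
Definition dist (u v : T) : nat := find (walk_of_len u v) (iota 0 #|T|).

Definition spaths (k l : T) : {set (dist k l).-tuple T} :=
  [set p : (dist k l).-tuple T | path e k p && (last k p == l)].
Definition s_num (k l : T) : nat := #|spaths k l|.

Definition uses_edge (u v k : T) (p : seq T) : bool :=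
  ((u, v) \in zip (k :: p) p) || ((v, u) \in zip (k :: p) p).
Definition s_edge (u v k l : T) : nat :=
  #|[set p in spaths k l | uses_edge u v k p]|.

Definition vertex_transitive :=
  forall u v : T, exists f : {perm T}, (forall x y, e (f x) (f y) = e x y) /\ f u = v.

Local Open Scope ring_scope.
Variables (R : realFieldType) (lam : R).

Definition t_e (u : T) : R :=
  \sum_(v : T | v != u) (dist u v)%:R * lam ^+ dist u v.

(* sum over unordered pairs {k,l} of distinct vertices, each counted once
   (via the enumeration order of T) *)
Definition b_e (u v : T) : R :=
  \sum_(k : T) \sum_(l : T | (enum_rank k < enum_rank l)%N)
     ((s_edge u v k l)%:R / (s_num k l)%:R) * lam ^+ dist k l.

Definition c_e (u : T) : R := \sum_(v : T | e u v) b_e u v.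

Definition networkness (u : T) : R := c_e u / t_e u.

(* minimum over all vertices; u0 is any vertex (the value does not depend on it) *)
Definition min_networkness (u0 : T) : R :=
  \big[Num.min/networkness u0]_(u : T) networkness u.
End Graph.

(* broom on n vertices 0..n-1: path 0-1-...-D, vertices > D adjacent to D-1 *)
Definition broom_rel (n D : nat) : rel 'I_n := fun x y =>
  [|| ((x.+1 == y) && (y <= D))%N, ((y.+1 == x) && (x <= D))%N,
      ((D < x)%N && (y == D.-1 :> nat)) | ((D < y)%N && (x == D.-1 :> nat))].

Arguments broom_rel : clear implicits.

Local Open Scope ring_scope.
Definition broom_val (R : realFieldType) (lam : R) (n D : nat) : R :=
  (lam ^+ D + (n - D)%:R^-1 * ((lam ^+ D - lam) / (lam - 1))) /
  (D%:R * lam ^+ D + (n - D)%:R^-1 *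
     ((lam - D%:R * lam ^+ D + (D - 1)%:R * lam ^+ D.+1) / (lam - 1) ^+ 2)).

Definition lower_bound (R : realFieldType) (lam : R) (n : nat) : R :=
  \big[Num.min/broom_val lam n 2]_(2 <= D < n) broom_val lam n D.

(* Main.v *)
(** Every shortest path ending at [u] uses one edge at [u], so
    [c_e u >= \sum_(v != u) lam ^+ d(u, v)], with equality when [u] is a leaf,
    since a leaf is interior to no shortest path.  With [m] the claimed lower bound
    and [g i = lam ^+ i * (1 - m * i)], it remains to see that the sum of [g] over
    the distances from [u] is nonnegative.  If [g] is minimal on the occurring
    distances at [j], keeping one vertex at each of the distances 1, ..., j - 1 and
    moving all the others to distance [j] can only decrease this sum, and produces
    the distances from the starting vertex of a broom.

    Summing over all vertices, a shortest path of length [d] is counted [2 d] times,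
    so [c_e] and [t_e] have the same total: some networkness is at most 1, and all
    equal 1 when they coincide. *)
Require Import Defs.
From HB Require Import structures.
From mathcomp Require Import all_boot all_order all_algebra perm.
From mathcomp Require Import zify ring.
Import Order.TTheory GRing.Theory Num.Theory.
Set Implicit Arguments. Unset Strict Implicit. Unset Printing Implicit Defensive.

(** * Distances and geodesics in a connected graph *)

Section Distance.
Variables (T : finType) (e : rel T).

Lemma dist_le_size (u : T) (p : seq T) : path e u p -> dist e u (last u p) <= size p.
Proof.
move=> e_p; rewrite leqNgt; apply/negP => lt_p.
have lt_pT : size p < #|T|.
  by rewrite (leq_trans lt_p) // -[X in _ <= X](size_iota 0) find_size.
have := before_find 0 lt_p; rewrite nth_iota // => /negbT/negP[].
by apply/existsP; exists (in_tuple p); rewrite /= e_p eqxx.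
Qed.

Lemma dist_refl (u : T) : dist e u u = 0.
Proof. by apply/eqP; rewrite -leqn0; exact: (@dist_le_size u [::]). Qed.

Hypothesis e_conn : connected_graph e.

(** This says that the search in [dist] succeeds, since [find] returns [#|T|] on failure. A walk
    without repetition has at most [#|T|] vertices, hence fewer edges. *)
Lemma dist_lt_card (u v : T) : dist e u v < #|T|.
Proof.
have /connectP[p0 e_p0 ->] := e_conn u v.
case: (shortenP e_p0) => p e_p uniq_p _.
apply: leq_ltn_trans (dist_le_size e_p) _.
by rewrite -[(size p).+1]/(size (u :: p)) -(card_uniqP uniq_p) max_card.
Qed.

Lemma geodesic_exists (u v : T) :
  exists p : seq T, [/\ path e u p, last u p = v & size p = dist e u v].
Proof.
have lt_uv := dist_lt_card u v.
have: has (walk_of_len e u v) (iota 0 #|T|) by rewrite has_find size_iota.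
move=> /(nth_find 0); rewrite (nth_iota 0 0 lt_uv) /walk_of_len => /existsP[p /andP[e_p /eqP p_v]].
by exists p; rewrite size_tuple.
Qed.

Lemma dist_eq0 (u v : T) : (dist e u v == 0) = (v == u).
Proof.
apply/idP/eqP => [/eqP d0|->]; last by rewrite dist_refl.
by have [[|x p] [_ /= p_v]] := geodesic_exists u v; rewrite d0.
Qed.

Lemma dist_edge (u v w : T) : e v w -> dist e u w <= (dist e u v).+1.
Proof.
move=> e_vw; have [p [e_p p_v <-]] := geodesic_exists u v.
rewrite -(size_rcons p w) -[w in X in X <= _](last_rcons u p).
by apply: dist_le_size; rewrite rcons_path e_p p_v.
Qed.

(** Along a walk from [u] to [v] the distance from [u] starts at 0 and grows by at most one per
    step, so it skips no value. *)
Lemma dist_level (u v : T) (i : nat) :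
  i <= dist e u v -> exists w, dist e u w = i.
Proof.
have /connectP[p e_p ->] := e_conn u v.
elim/last_ind: p e_p => [|p x IHp] /=.
  by rewrite dist_refl leqn0 => _ /eqP->; exists u; rewrite dist_refl.
rewrite rcons_path last_rcons => /andP[e_p /(dist_edge u) le_x] le_i.
have [/(IHp e_p)//|lt_i] := leqP i (dist e u (last u p)).
by exists x; lia.
Qed.

(** Cutting the loops out of [p] leaves a walk to the same end, which cannot be shorter; so there
    was no loop to cut. *)
Lemma geodesic_uniq (u : T) (p : seq T) :
  path e u p -> size p = dist e u (last u p) -> uniq (u :: p).
Proof.
move=> e_p; case: (shortenP e_p) => q e_q uniq_q sub_q size_p.
apply: (leq_size_uniq uniq_q); last by rewrite /= size_p ltnS dist_le_size.
by move=> x; rewrite !inE => /predU1P[->|/sub_q ->]; rewrite ?eqxx ?orbT.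
Qed.

End Distance.

(** A certificate for computing distances, later applied to brooms. Following the descent of [h]
    down to [u] gives a walk of length at most [h v]; since [h] grows by at most one per edge, no
    walk is shorter than [h v]. *)
Lemma dist_potential (T : finType) (e : rel T) (u : T) (h : T -> nat) :
    symmetric e -> h u = 0 -> (forall x y, e x y -> h y <= (h x).+1) ->
    (forall x, x != u -> exists2 y, e x y & (h y).+1 = h x) ->
  connected_graph e /\ forall v, dist e u v = h v.
Proof.
move=> e_sym hu0 h_lip h_desc.
have walk v : exists p, [/\ path e u p, last u p = v & size p <= h v].
  have [n le_n] := ubnP (h v); elim: n v le_n => // n IHn v le_n.
  have [->|/h_desc[y e_vy hy]] := eqVneq v u; first by exists [::].
  have [|p [e_p p_y le_p]] := IHn y; first lia.
  exists (rcons p v); rewrite rcons_path last_rcons size_rcons e_p p_y e_sym e_vy.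
  by split=> //; lia.
have conn_u v : connect e u v.
  by have [p [e_p p_v _]] := walk v; apply/connectP; exists p.
have e_conn : connected_graph e.
  by move=> x y; apply: connect_trans (conn_u y); rewrite (sym_connect_sym e_sym).
split=> // v; apply/eqP; rewrite eqn_leq; apply/andP; split.
  have [p [e_p <- le_p]] := walk v.
  exact: leq_trans (dist_le_size e_p) le_p.
have [p [e_p <- <-]] := geodesic_exists e_conn u v.
elim/last_ind: p e_p => [|p x IHp]; first by rewrite /= hu0.
rewrite rcons_path last_rcons size_rcons => /andP[e_p /h_lip].
by have := IHp e_p; lia.
Qed.

(** * Edges traversed by a walk *)

Section UsesEdge.
Variable T : finType.
Implicit Types (u v k x : T) (p : seq T).

Lemma uses_edgeC u v k p : uses_edge u v k p = uses_edge v u k p.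
Proof. by rewrite /uses_edge orbC. Qed.

Lemma uses_edge_cons u v k x p :
  uses_edge u v k (x :: p) =
  [|| ((u, v) == (k, x)), ((v, u) == (k, x)) | uses_edge u v x p].
Proof. by rewrite /uses_edge /= !inE -!orbA; do !bool_congr. Qed.

Lemma uses_edge_rcons u v k x p :
  uses_edge u v k (rcons p x) =
  [|| ((u, v) == (last k p, x)), ((v, u) == (last k p, x)) | uses_edge u v k p].
Proof.
elim: p k => [|y p IHp] k /=; first exact: uses_edge_cons.
by rewrite !uses_edge_cons IHp; do !bool_congr.
Qed.

Lemma uses_edge_mem u v k p : uses_edge u v k p -> u \in k :: p.
Proof.
elim: p k => [|x p IHp] k; first by rewrite /uses_edge /= !in_nil.
rewrite uses_edge_cons => /or3P[/eqP[-> _]|/eqP[_ ->]|/IHp u_p].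
- exact: mem_head.
- by rewrite !inE eqxx orbT.
- by rewrite inE u_p orbT.
Qed.

Lemma uses_edge_path (e : rel T) u v k p :
  symmetric e -> path e k p -> uses_edge u v k p -> e u v.
Proof.
move=> e_sym; elim: p k => [|x p IHp] k; first by rewrite /uses_edge /= !in_nil.
rewrite uses_edge_cons /= => /andP[e_kx e_p].
by case/or3P => [/eqP[-> ->]|/eqP[-> ->]|/(IHp _ e_p)] //; rewrite e_sym.
Qed.

Lemma last_rev_belast k x p : last x (rev (belast k p)) = if p is [::] then x else k.
Proof. by case: p => [|y p] //=; rewrite rev_cons last_rcons. Qed.

Lemma uses_edge_rev u v k p :
  uses_edge u v (last k p) (rev (belast k p)) = uses_edge u v k p.
Proof.
elim: p k => [|x p IHp] k //=.
rewrite rev_cons uses_edge_rcons IHp uses_edge_cons last_rev_belast.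
(* For empty [p] the reversed walk is empty too, and [last] returns its default [last x p], which is
   then [x]. *)
have -> : (if p is [::] then last x p else x) = x by case: p {IHp}.
by rewrite !xpair_eqE ![_ && (_ == k)]andbC orbCA.
Qed.

(** Without repeated vertices the [size p] edges of the walk are distinct, and each is met once in
    either orientation. *)
Lemma sum_uses_edge k p : uniq (k :: p) ->
  \sum_u \sum_v (uses_edge u v k p : nat) = 2 * size p.
Proof.
elim: p k => [|x p IHp] k.
  by move=> _; rewrite big1 // => u _; rewrite big1 // => v _.
move=> /= /andP[k_p uniq_p].
transitivity (\sum_u \sum_v (((u == k) && (v == x)) + ((u == x) && (v == k)) +
    uses_edge u v x p)).
  apply: eq_bigr => u _; apply: eq_bigr => v _.
  rewrite uses_edge_cons !xpair_eqE andbC [(v == k) && _]andbC.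
  have [->|nuk] := eqVneq u k.
    have nuse y : uses_edge k y x p = false by apply: contraNF k_p => /uses_edge_mem.
    have -> : k == x = false by apply: contraNF k_p => /eqP->; rewrite mem_head.
    by rewrite nuse andbT !addn0 orbF; case: (v == x).
  rewrite andbF /=.
  have [->|nvk] := eqVneq v k; last by rewrite !andbF.
  have -> : uses_edge u k x p = false.
    by rewrite uses_edgeC; apply: contraNF k_p => /uses_edge_mem.
  by rewrite orbF addn0.
have sum_pair (a b : T) : \sum_u \sum_v (((u == a) && (v == b)) : nat) = 1.
  rewrite (bigD1 a) //= (bigD1 b) //= !eqxx /= big1 => [|v /negPf->] //.
  by rewrite big1 // => u /negPf->; rewrite big1.
under eq_bigr => u _ do rewrite !big_split /=.
by rewrite !big_split /= !sum_pair IHp //= mulnS.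
Qed.

End UsesEdge.

(** * Counting shortest paths through the edges at a vertex *)

Lemma leq_card_in_imset (A B : finType) (f : A -> B) (X : {set A}) (Y : {set B}) :
  {in X &, injective f} -> {in X, forall x, f x \in Y} -> #|X| <= #|Y|.
Proof.
move=> f_inj f_XY; rewrite -(card_in_imset f_inj); apply: subset_leq_card.
by apply/subsetP => _ /imsetP[x Xx ->]; apply: f_XY.
Qed.

Section Usage.
Variables (T : finType) (e : rel T).
Hypotheses (e_graph : simple_graph e) (e_conn : connected_graph e).
Let e_sym : symmetric e := proj1 e_graph.

Lemma path_rev (k : T) (p : seq T) : path e k p -> path e (last k p) (rev (belast k p)).
Proof. by rewrite rev_path (eq_path (e' := e)) // => x y; apply: e_sym. Qed.

Lemma dist_sym (u v : T) : dist e u v = dist e v u.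
Proof.
have le_dist x y : dist e x y <= dist e y x.
  have [p [e_p p_x <-]] := geodesic_exists e_conn y x.
  have := dist_le_size (path_rev e_p).
  rewrite size_rev size_belast p_x last_rev_belast.
  by case: p p_x {e_p} => [|z p] //= ->.
by apply/eqP; rewrite eqn_leq !le_dist.
Qed.

(** Reversal is injective on paths with a common last vertex. The predicates allow one injection to
    serve both [s_edge] and [s_num]. *)
Lemma leq_card_spaths_rev (k l : T) (P Q : pred (seq T)) :
    (forall p, last k p = l -> P p -> Q (rev (belast k p))) ->
  #|[set p in spaths e k l | P p]| <= #|[set p in spaths e l k | Q p]|.
Proof.
move=> PQ; rewrite /spaths (dist_sym l k).
pose f (p : (dist e k l).-tuple T) := [tuple of rev (belast k p)].
apply: (@leq_card_in_imset _ _ f) => [p q|p].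
  rewrite !inE => /andP[/andP[_ /eqP p_l] _] /andP[/andP[_ /eqP q_l] _].
  move=> /(congr1 val) /= /(can_inj revK) eq_belast; apply: val_inj.
  have eq_last : last k p = last k q by rewrite p_l q_l.
  have := lastI k p; rewrite eq_belast eq_last -lastI.
  by case.
rewrite !inE => /andP[/andP[e_p /eqP p_l] p_P].
have := path_rev e_p; rewrite p_l /= => -> /=; rewrite PQ // last_rev_belast andbT.
by case: (tval p) p_l => [|x s] //= ->.
Qed.

Lemma s_edge_rev (u v k l : T) : s_edge e u v k l = s_edge e u v l k.
Proof.
suff le_rev k' l' : s_edge e u v k' l' <= s_edge e u v l' k'.
  by apply/eqP; rewrite eqn_leq !le_rev.
by apply: leq_card_spaths_rev => p <-; rewrite uses_edge_rev.
Qed.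

Lemma s_num_rev (k l : T) : s_num e k l = s_num e l k.
Proof.
suff le_rev k' l' : s_num e k' l' <= s_num e l' k'.
  by apply/eqP; rewrite eqn_leq !le_rev.
have := @leq_card_spaths_rev k' l' predT predT (fun _ _ => id).
have setT_id (A : finType) (X : {set A}) : [set x in X | true] = X.
  by apply/setP => x; rewrite inE andbT.
by rewrite !setT_id.
Qed.

Lemma s_num_gt0 (k l : T) : 0 < s_num e k l.
Proof.
have [p [e_p p_l p_d]] := geodesic_exists e_conn k l.
apply/card_gt0P; exists (tcast p_d (in_tuple p)).
by rewrite inE val_tcast e_p p_l eqxx.
Qed.

(** For [k] and [l] distinct, a shortest path counts once if it ends at [u] and twice if [u] is
    interior. Divided by [s_num e k l], this is the coefficient with which the pair enters [c_e]. *)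
Definition usage (u k l : T) : nat := \sum_(v | e u v) s_edge e u v k l.

Lemma usageE (u k l : T) :
  usage u k l = \sum_(p in spaths e k l) \sum_(v | e u v) uses_edge u v k p.
Proof.
rewrite exchange_big; apply: eq_bigr => v _ /=.
rewrite -big_mkcondr /= /s_edge -sum1_card.
by apply: eq_bigl => p; rewrite inE.
Qed.

Lemma spaths_uniq (k l : T) (p : (dist e k l).-tuple T) :
  p \in spaths e k l -> uniq (k :: p).
Proof.
rewrite inE => /andP[e_p /eqP p_l].
by apply: geodesic_uniq e_p _; rewrite size_tuple p_l.
Qed.

Lemma usage_rev (u k l : T) : usage u k l = usage u l k.
Proof. by apply: eq_bigr => v _; apply: s_edge_rev. Qed.

Lemma usage_endpoint (k l : T) : l != k -> s_num e k l <= usage k k l.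
Proof.
move=> nlk; rewrite usageE /s_num -sum1_card; apply: leq_sum => p.
rewrite inE => /andP[e_p /eqP p_l].
case: (tval p) e_p p_l => [|x s] /=; first by move=> _ eq_kl; rewrite eq_kl eqxx in nlk.
move=> /andP[e_kx _] _; rewrite (bigD1 x) //=.
by rewrite uses_edge_cons eqxx.
Qed.

Lemma usage_total (k l : T) : \sum_u usage u k l = 2 * dist e k l * s_num e k l.
Proof.
under eq_bigr => u _ do rewrite usageE.
rewrite exchange_big mulnC /= /s_num -sum_nat_const; apply: eq_bigr => p p_kl.
rewrite -{2}(size_tuple p) -(sum_uses_edge (spaths_uniq p_kl)).
apply: eq_bigr => u _; rewrite big_mkcond; apply: eq_bigr => v _.
(* Dropping the condition [e u v] adds nothing, as a path traverses only edges of the graph. *)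
case: ifP => // ne_uv; case: (boolP (uses_edge _ _ _ _)) => // p_uv.
move: p_kl; rewrite inE => /andP[e_p _].
by rewrite (uses_edge_path e_sym e_p p_uv) in ne_uv.
Qed.

Lemma usage_leaf_le (u w k l : T) :
  (forall v, e u v -> v = w) -> usage u k l <= s_num e k l.
Proof.
move=> leaf_u; rewrite usageE /s_num -sum1_card; apply: leq_sum => p _.
rewrite big_mkcond (bigD1 w) //= big1 => [|v nvw].
  by rewrite addn0; case: ifP => // _; apply: leq_b1.
by case: ifP => // /leaf_u eq_vw; rewrite eq_vw eqxx in nvw.
Qed.

(** If a leaf were interior to a shortest path, its only neighbour [w] would come both before and
    after it, contradicting that shortest paths repeat no vertex. *)
Lemma usage_leaf_eq0 (u w k l : T) :
  (forall v, e u v -> v = w) -> u != k -> u != l -> usage u k l = 0.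
Proof.
move=> leaf_u nuk nul; rewrite usageE big1 // => p p_kl.
rewrite big1 // => v _; apply/eqP; rewrite eqb0; apply/negP => p_uv.
have uniq_p := spaths_uniq p_kl; move: p_kl; rewrite inE => /andP[e_p p_l].
have := uses_edge_mem p_uv; rewrite inE (negPf nuk) /= => u_p.
case/splitPr: u_p e_p p_l uniq_p => p1 p2.
rewrite cat_path last_cat -cat_cons cat_uniq => /and3P[_ e_1 e_2] p_l.
move=> /and3P[_ /hasPn disj _].
case: p2 e_2 p_l disj => [|y p2] /=; first by rewrite (negPf nul).
move=> /andP[/leaf_u -> _] _ /(_ w); rewrite !inE eqxx orbT => /(_ isT).
by rewrite e_sym in e_1; rewrite -(leaf_u _ e_1) -in_cons mem_last.
Qed.

(** * Invariance under automorphisms *)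

Lemma dist_perm (f : {perm T}) (u v : T) :
  (forall x y, e (f x) (f y) = e x y) -> dist e (f u) (f v) = dist e u v.
Proof.
move=> f_e.
have le_dist (g : {perm T}) x y : (forall x y, e (g x) (g y) = e x y) ->
    dist e (g x) (g y) <= dist e x y.
  move=> g_e; have [p [e_p <- <-]] := geodesic_exists e_conn x y.
  rewrite -last_map -(size_map g); apply: dist_le_size.
  by rewrite path_map (eq_path (e' := e)).
apply/eqP; rewrite eqn_leq le_dist //=.
(* The reverse inequality is [le_dist] for the inverse automorphism. *)
rewrite -{1}(permK f u) -{1}(permK f v); apply: le_dist => x y.
by rewrite -f_e !permKV.
Qed.

Lemma uses_edge_perm (f : {perm T}) (u v k : T) (p : seq T) :
  uses_edge (f u) (f v) (f k) (map f p) = uses_edge u v k p.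
Proof.
elim: p k => [|x p IHp] k //=.
by rewrite !uses_edge_cons IHp !xpair_eqE !(inj_eq perm_inj).
Qed.

Lemma map_tuple_perm_inj (f : {perm T}) (n : nat) : injective (@map_tuple n _ _ f).
Proof.
by move=> p q /(congr1 val) /(inj_map (@perm_inj _ f)) eq_pq; apply: val_inj.
Qed.

Lemma s_num_perm (f : {perm T}) (k l : T) :
  (forall x y, e (f x) (f y) = e x y) -> s_num e (f k) (f l) = s_num e k l.
Proof.
move=> f_e; rewrite /s_num /spaths dist_perm //.
rewrite -(card_preimset _ (@map_tuple_perm_inj f _)); apply: eq_card => p.
by rewrite !inE path_map (eq_path (e' := e)) // last_map (inj_eq perm_inj).
Qed.

Lemma s_edge_perm (f : {perm T}) (u v k l : T) :
  (forall x y, e (f x) (f y) = e x y) ->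
  s_edge e (f u) (f v) (f k) (f l) = s_edge e u v k l.
Proof.
move=> f_e; rewrite /s_edge /spaths dist_perm //.
rewrite -(card_preimset _ (@map_tuple_perm_inj f _)); apply: eq_card => p.
rewrite !inE path_map (eq_path (e' := e)) // last_map (inj_eq perm_inj).
by rewrite uses_edge_perm.
Qed.

Lemma usage_perm (f : {perm T}) (u k l : T) :
  (forall x y, e (f x) (f y) = e x y) -> usage (f u) (f k) (f l) = usage u k l.
Proof.
move=> f_e; rewrite /usage (reindex_inj (@perm_inj _ f)) /=.
by apply: eq_big => [v|v _]; rewrite ?f_e ?s_edge_perm.
Qed.

End Usage.

(** * Comparison of [c_e] and [t_e], and the upper bound *)

Local Open Scope ring_scope.

(** Passes from unordered pairs, represented by the enumeration order in [b_e], to ordered pairs,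
    where sums can be split at a given vertex and exchanged. *)
Lemma sum_offdiag_sym (R : pzRingType) (T : finType) (F : T -> T -> R) :
    (forall k l, F k l = F l k) ->
  \sum_k \sum_(l | l != k) F k l =
  2 * \sum_k \sum_(l | (enum_rank k < enum_rank l)%N) F k l.
Proof.
move=> F_sym; set S := \sum_k \sum_(l | (_ < _)%N) _.
have S_flip : S = \sum_k \sum_(l | (enum_rank l < enum_rank k)%N) F k l.
  rewrite /S (exchange_big_dep xpredT) //=.
  by apply: eq_bigr => k _; apply: eq_bigr => l _; apply: F_sym.
rewrite mulr_natl mulr2n {2}S_flip -big_split /=; apply: eq_bigr => k _.
rewrite (bigID (fun l => (enum_rank k < enum_rank l)%N)) /=.
congr (_ + _); apply: eq_bigl => l; rewrite -(inj_eq enum_rank_inj) -val_eqE /=; lia.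
Qed.

Section Centralities.
Variables (R : realFieldType) (lam : R).
Hypothesis lam_gt0 : 0 < lam.
Let lam_ge0 : 0 <= lam := ltW lam_gt0.
Variables (T : finType) (e : rel T).
Hypotheses (e_graph : simple_graph e) (e_conn : connected_graph e).

Let W (u k l : T) : R := (usage e u k l)%:R / (s_num e k l)%:R * lam ^+ dist e k l.

Let s_numR_gt0 (k l : T) : 0 < (s_num e k l)%:R :> R.
Proof. by rewrite ltr0n s_num_gt0. Qed.

Lemma c_e_ordered (u : T) : 2 * c_e e lam u = \sum_k \sum_(l | l != k) W u k l.
Proof.
rewrite sum_offdiag_sym => [|k l]; last first.
  by rewrite /W usage_rev // s_num_rev // dist_sym.
congr (_ * _); rewrite /c_e /b_e exchange_big; apply: eq_bigr => k _.
rewrite exchange_big; apply: eq_bigr => l _ /=.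
by rewrite -!mulr_suml /W /usage natr_sum.
Qed.

Lemma c_e_ge (u : T) : \sum_(v | v != u) lam ^+ dist e u v <= c_e e lam u.
Proof.
(* The factor 2 is matched by the ordered pairs having [u] as first and as second entry; all other
   pairs are dropped. *)
rewrite -(ler_pM2l (ltr0n R 2)) c_e_ordered [leRHS](bigD1 u) //= mulr_natl mulr2n.
have W_ge0 k l : 0 <= W u k l by rewrite !mulr_ge0 ?invr_ge0 ?exprn_ge0 ?ler0n.
have W_end l : l != u -> lam ^+ dist e u l <= W u u l.
  move=> nlu; rewrite ler_peMl ?exprn_ge0 //.
  by rewrite ler_pdivlMr // mul1r ler_nat usage_endpoint.
apply: lerD; apply: ler_sum => l nlu; first exact: W_end.
rewrite (bigD1 u) 1?eq_sym //= ler_wpDr //; first by apply: sumr_ge0.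
have -> : W u l u = W u u l by rewrite /W usage_rev // s_num_rev // dist_sym.
exact: W_end.
Qed.

Lemma c_e_leaf (u w : T) : (forall v, e u v -> v = w) ->
  c_e e lam u = \sum_(v | v != u) lam ^+ dist e u v.
Proof.
move=> leaf_u; apply/eqP; rewrite eq_le c_e_ge andbT.
rewrite -(ler_pM2l (ltr0n R 2)) c_e_ordered [leLHS](bigD1 u) //= mulr_natl mulr2n.
have W_le k l : W u k l <= lam ^+ dist e k l.
  rewrite ler_piMl ?exprn_ge0 // ler_pdivrMr // mul1r ler_nat.
  exact: usage_leaf_le leaf_u.
apply: lerD; apply: ler_sum => l nlu //.
(* Of the pairs whose first entry is not [u], only the one ending at [u] contributes. *)
rewrite (bigD1 u) 1?eq_sym //= big1 ?addr0 => [|k /andP[_ nku]].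
  by rewrite dist_sym // W_le.
by rewrite /W (usage_leaf_eq0 e_graph leaf_u) ?mul0r // eq_sym.
Qed.

Lemma sum_c_e_eq_sum_t_e : \sum_u c_e e lam u = \sum_u t_e e lam u.
Proof.
apply: (mulfI (x := 2)); first by rewrite pnatr_eq0.
rewrite mulr_sumr; under eq_bigr => u _ do rewrite c_e_ordered.
rewrite exchange_big mulr_sumr /=; apply: eq_bigr => k _.
rewrite exchange_big mulr_sumr /=; apply: eq_bigr => l _.
rewrite -!mulr_suml -natr_sum usage_total // !natrM mulfK ?mulrA //.
by rewrite gt_eqF.
Qed.

Lemma t_e_gt0 (u : T) : (2 <= #|T|)%N -> 0 < t_e e lam u.
Proof.
rewrite (cardD1 u) inE add1n ltnS => /card_gt0P[v]; rewrite !inE andbT => nvu.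
have d_gt0 w : w != u -> (0 < dist e u w)%N by rewrite lt0n dist_eq0.
rewrite /t_e (bigD1 v) //= ltr_wpDr //.
  by apply: sumr_ge0 => w _; rewrite mulr_ge0 ?exprn_ge0.
by rewrite mulr_gt0 ?exprn_gt0 // ltr0n d_gt0.
Qed.

Lemma networkness_perm (f : {perm T}) (u : T) :
  (forall x y, e (f x) (f y) = e x y) ->
  networkness e lam (f u) = networkness e lam u.
Proof.
move=> f_e; congr (_ / _); last first.
  rewrite /t_e (reindex_inj (@perm_inj _ f)) /=.
  by apply: eq_big => [v|v _]; rewrite ?(inj_eq perm_inj) ?dist_perm.
apply: (mulfI (x := 2)); first by rewrite pnatr_eq0.
rewrite !c_e_ordered.
rewrite (reindex_inj (@perm_inj _ f)) /=; apply: eq_bigr => k _.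
rewrite (reindex_inj (@perm_inj _ f)) /=.
apply: eq_big => [l|l _]; first by rewrite (inj_eq perm_inj).
by rewrite /W usage_perm // s_num_perm // dist_perm.
Qed.

Lemma min_networkness_le1 (u0 : T) :
  (2 <= #|T|)%N -> min_networkness e lam u0 <= 1.
Proof.
move=> card_T; rewrite leNgt; apply/negP => gt1.
have c_gt u : t_e e lam u < c_e e lam u.
  rewrite -[X in X < _]mul1r -ltr_pdivlMr ?t_e_gt0 //.
  by apply: lt_le_trans gt1 _; apply: bigmin_le.
have /eqP := sum_c_e_eq_sum_t_e; rewrite eq_sym -subr_eq0 -sumrB.
rewrite lt_eqF // (bigD1 u0) //= -[X in _ < X](addr0 0).
by rewrite ltr_leD ?subr_lt0 // sumr_le0 // => u _; rewrite subr_le0 ltW.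
Qed.

Lemma min_networkness_const (u0 : T) (x : R) :
  (forall u, networkness e lam u = x) -> min_networkness e lam u0 = x.
Proof.
by move=> N_x; rewrite /min_networkness bigmin_eq_id => [|u _]; rewrite ?N_x.
Qed.

(** Automorphisms preserve networkness, so [c_e] is a constant multiple of [t_e]; as their totals
    agree and are positive, the constant is 1. *)
Lemma vertex_transitive_networkness (u0 : T) :
  (2 <= #|T|)%N -> vertex_transitive e -> networkness e lam u0 = 1.
Proof.
move=> card_T trans_e.
have N_const u : networkness e lam u = networkness e lam u0.
  by have [f [f_e <-]] := trans_e u0 u; apply: networkness_perm.
have c_N u : c_e e lam u = networkness e lam u0 * t_e e lam u.
  by rewrite -(N_const u) divfK // gt_eqF // t_e_gt0.
apply: (mulIf (x := \sum_u t_e e lam u)).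
  rewrite gt_eqF // (bigD1 u0) //= ltr_wpDr ?t_e_gt0 //.
  by apply: sumr_ge0 => u _; rewrite ltW ?t_e_gt0.
rewrite mul1r -{2}sum_c_e_eq_sum_t_e mulr_sumr.
by apply: eq_bigr => u _; rewrite c_N.
Qed.

(** Every distance below [j] is attained because [v] is at least that far away. One vertex is kept
    per distance, and the remaining terms are nonnegative. *)
Lemma sum_levels_le (u v : T) (F : nat -> R) (j : nat) :
    (forall w, w != u -> 0 <= F (dist e u w)) -> (j <= dist e u v)%N ->
  \sum_(1 <= i < j) F i <= \sum_(w | (w != u) && (dist e u w < j)%N) F (dist e u w).
Proof.
move=> F_ge0; elim: j => [|j IHj] le_j.
  by rewrite big_geq // sumr_ge0 // => w /andP[/F_ge0].
have [->|j_gt0] := posnP j.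
  by rewrite big_geq // sumr_ge0 // => w /andP[/F_ge0].
have [w dw] := dist_level e_conn (ltnW le_j).
have nwu : w != u by rewrite -(dist_eq0 e_conn) dw -lt0n.
rewrite big_nat_recr //= [leRHS](bigD1 w) /=; last by rewrite nwu dw ltnS leqnn.
rewrite dw addrC lerD2l (le_trans (IHj (ltnW le_j))) //.
rewrite [leLHS]big_mkcond [leRHS]big_mkcond /=; apply: ler_sum => x _.
have [->|nxu] //= := eqVneq x u.
have [->|nxw] /= := eqVneq x w; first by rewrite dw ltnn andbF.
rewrite andbT ltnS; case: (ltnP (dist e u x) j) => [/ltnW ->|_] //.
by case: ifP => // _; apply: F_ge0.
Qed.

End Centralities.

(** * Sums over broom distances and their relation to [broom_val] *)

Section BroomSum.
Variable R : realFieldType.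
Implicit Types (lam m : R) (f g : nat -> R).

(* The sum of [g] over the distances to the starting vertex of a broom: one vertex
   at each distance below [D], and [n - D] vertices at distance [D]. *)
Definition broom_sum (g : nat -> R) (n D : nat) : R :=
  \sum_(1 <= i < D) g i + (n - D)%:R * g D.

Lemma broom_sumB f g m (n D : nat) :
  broom_sum (fun i => f i - m * g i) n D = broom_sum f n D - m * broom_sum g n D.
Proof. by rewrite /broom_sum sumrB -mulr_sumr; ring. Qed.

Lemma ler_broom_sum f g (n D : nat) : (0 < D)%N ->
  (forall i, (0 < i)%N -> f i <= g i) -> broom_sum f n D <= broom_sum g n D.
Proof.
move=> D_gt0 le_fg; rewrite lerD ?ler_wpM2l ?ler0n ?le_fg //.
by rewrite !big_nat; apply: ler_sum => i /andP[i_gt0 _]; apply: le_fg.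
Qed.

Lemma broom_sum_gt0 g (n D : nat) : (0 < D < n)%N ->
  (forall i, (0 < i)%N -> 0 < g i) -> 0 < broom_sum g n D.
Proof.
move=> /andP[D_gt0 lt_Dn] g_gt0.
rewrite /broom_sum ltr_wpDl ?mulr_gt0 ?ltr0n ?subn_gt0 ?g_gt0 //.
by rewrite big_nat sumr_ge0 // => i /andP[/g_gt0/ltW].
Qed.

Lemma sum_geometric lam (D : nat) : lam != 1 -> (0 < D)%N ->
  \sum_(1 <= i < D) lam ^+ i = (lam ^+ D - lam) / (lam - 1).
Proof.
rewrite -subr_eq0 => lam1; case: D => // D _.
elim: D => [|D IHD]; first by rewrite big_geq // expr1 subrr mul0r.
rewrite big_nat_recr //= IHD [lam ^+ D.+2]exprS; field; exact: lam1.
Qed.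

Lemma sum_arith_geometric lam (D : nat) : lam != 1 -> (0 < D)%N ->
  \sum_(1 <= i < D) i%:R * lam ^+ i =
  (lam - D%:R * lam ^+ D + (D - 1)%:R * lam ^+ D.+1) / (lam - 1) ^+ 2.
Proof.
rewrite -subr_eq0 => lam1; case: D => // D _; rewrite subn1 /=.
elim: D => [|D IHD]; first by rewrite big_geq // expr1; field.
rewrite big_nat_recr //= IHD -[D.+2%:R]natr1 -[D.+1%:R]natr1 [lam ^+ D.+3]exprS.
rewrite [lam ^+ D.+2]exprS; field; exact: lam1.
Qed.

Variable lam : R.
Hypotheses (lam_gt0 : 0 < lam) (lam_lt1 : lam < 1).

Lemma broom_valE (n D : nat) : (0 < D < n)%N ->
  broom_val lam n D =
  broom_sum (fun i => lam ^+ i) n D / broom_sum (fun i => i%:R * lam ^+ i) n D.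
Proof.
move=> /andP[D_gt0 lt_Dn]; have lam_neq1 : lam != 1 by rewrite lt_eqF.
rewrite /broom_val -sum_geometric // -sum_arith_geometric // /broom_sum.
set c := (n - D)%:R; have c_neq0 : c != 0 by rewrite pnatr_eq0 -lt0n subn_gt0.
(* Numerator and denominator of [broom_val] are the broom sums divided by [c], the number of
   vertices at distance [D]. *)
have divc (x y : R) : x + c^-1 * y = (y + c * x) / c by field.
have cancel_c (x y : R) : (x / c) / (y / c) = x / y by rewrite invf_div mulrA divfK.
by rewrite !divc cancel_c.
Qed.

Lemma lower_bound_attained (n : nat) : (3 <= n)%N ->
  exists2 D : nat, (2 <= D < n)%N & lower_bound lam n = broom_val lam n D.
Proof.
move=> n_ge3; rewrite /lower_bound big_nat_cond.
apply: (big_ind (fun x => exists2 D, (2 <= D < n)%N & x = broom_val lam n D)).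
- by exists 2%N.
- move=> x y [i i_n ->] [j j_n ->]; rewrite /Order.min.
  by case: ifP => _; [exists i | exists j].
- by move=> i /andP[i_n _]; exists i.
Qed.

Lemma lower_bound_broom_sum (n D : nat) : (3 <= n)%N -> (0 < D < n)%N ->
  0 <= broom_sum (fun i => lam ^+ i - lower_bound lam n * (i%:R * lam ^+ i)) n D.
Proof.
move=> n_ge3 D_n; set m := lower_bound lam n.
have den_gt0 j : (0 < j < n)%N -> 0 < broom_sum (fun i => i%:R * lam ^+ i) n j.
  move=> j_n; apply: broom_sum_gt0 => // i i_gt0.
  by rewrite mulr_gt0 ?exprn_gt0 ?ltr0n.
have num_le_den j : (0 < j < n)%N ->
    broom_sum (fun i => lam ^+ i) n j <= broom_sum (fun i => i%:R * lam ^+ i) n j.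
  move=> /andP[j_gt0 _]; apply: ler_broom_sum => // i i_gt0.
  by rewrite ler_peMl ?exprn_ge0 ?(ltW lam_gt0) // ler1n.
have m_le j : (1 < j < n)%N -> m <= broom_val lam n j.
  by move=> j_n; apply: ge_bigmin_seq; rewrite // mem_index_iota.
(* Positive distances make every broom ratio at most 1; [D = 2] serves as a witness in the range of
   the minimum. *)
have m_le1 : m <= 1.
  apply: le_trans (m_le 2%N n_ge3) _.
  have n2 : (0 < 2 < n)%N by [].
  by rewrite broom_valE // ler_pdivrMr ?den_gt0 // mul1r num_le_den.
rewrite broom_sumB subr_ge0.
(* The value [D = 1] lies outside the minimum defining [m]. There both broom sums coincide, and
   [m <= 1] is what is required. *)
have [->|D_neq1] := eqVneq D 1%N.
  rewrite /broom_sum !big_geq // !add0r mul1r -[X in _ <= X]mul1r.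
  by rewrite ler_wpM2r // mulr_ge0 ?ler0n ?exprn_ge0 ?(ltW lam_gt0).
rewrite -ler_pdivlMr ?den_gt0 // -broom_valE // m_le //; lia.
Qed.

End BroomSum.

(** * The lower bound for an arbitrary connected graph *)

Section LowerBound.
Variables (R : realFieldType) (lam : R).
Hypotheses (lam_gt0 : 0 < lam) (lam_lt1 : lam < 1).
Variables (T : finType) (e : rel T).
Hypotheses (e_graph : simple_graph e) (e_conn : connected_graph e).

(** Subtracting the minimum [g (dist e u v)] makes all terms nonnegative, so [sum_levels_le]
    applies; vertices moved to the minimising distance then contribute zero. *)
Lemma broom_sum_le (g : nat -> R) (u v : T) : v != u ->
    (forall w, w != u -> g (dist e u v) <= g (dist e u w)) ->
  broom_sum g #|T| (dist e u v) <= \sum_(w | w != u) g (dist e u w).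
Proof.
move=> nvu g_min; set j := dist e u v.
have j_gt0 : (0 < j)%N by rewrite lt0n dist_eq0.
have lt_jT : (j < #|T|)%N by apply: dist_lt_card.
have le_levels : \sum_(1 <= i < j) (g i - g j) <=
    \sum_(w | w != u) (g (dist e u w) - g j).
  have g_ge0 w : w != u -> 0 <= g (dist e u w) - g j.
    by move=> /g_min; rewrite subr_ge0.
  apply: le_trans (sum_levels_le e_conn (F := fun i => g i - g j) g_ge0 (leqnn j)) _.
  rewrite big_mkcondr; apply: ler_sum => w nwu.
  by case: ifP => // _; apply: g_ge0.
move: le_levels; rewrite !sumrB !sumr_const_nat sumr_const.
have -> : #|[pred w | w != u]| = #|T|.-1 by apply: cardC1.
rewrite -!(mulr_natl (g j)) /broom_sum => le_levels.
(* Of the [#|T| - 1] vertices other than [u], [j - 1] are kept at the smaller distances. *)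
have -> : (#|T| - j)%:R = #|T|.-1%:R - (j - 1)%:R :> R.
  rewrite -natrB; last by lia.
  by congr (_%:R); lia.
by rewrite mulrBl addrA [_ + _ - _]addrAC -lerBrDr.
Qed.

Lemma lower_bound_le_networkness (u : T) :
  (3 <= #|T|)%N -> lower_bound lam #|T| <= networkness e lam u.
Proof.
move=> card_T; have card_T2 := ltnW card_T.
rewrite ler_pdivlMr ?t_e_gt0 //; apply: le_trans (c_e_ge lam_gt0 e_graph e_conn u).
set m := lower_bound _ _; rewrite -subr_ge0 /t_e mulr_sumr -sumrB.
pose g i := lam ^+ i - m * (i%:R * lam ^+ i).
have [v0 nv0u] : exists v, v != u.
  move: card_T2; rewrite (cardD1 u) inE add1n ltnS => /card_gt0P[v].
  by rewrite !inE andbT; exists v.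
case: (@arg_minP _ _ _ v0 (fun v => v != u) (fun v => g (dist e u v)) nv0u) => v nvu g_min.
apply: le_trans (broom_sum_le nvu g_min); apply: lower_bound_broom_sum => //.
by rewrite lt0n dist_eq0 // nvu dist_lt_card.
Qed.

Lemma lower_bound_le_min_networkness (u0 : T) :
  (3 <= #|T|)%N -> lower_bound lam #|T| <= min_networkness e lam u0.
Proof.
by move=> card_T; apply: le_bigmin => [|u _]; apply: lower_bound_le_networkness.
Qed.

End LowerBound.

(** * The networkness of the starting vertex of a broom *)

Section Broom.
Variables (n D : nat).
Hypotheses (D_ge2 : (2 <= D)%N) (lt_Dn : (D < n)%N) (n_gt0 : (0 < n)%N).
Let v0 := Ordinal n_gt0.
Let v1 := Ordinal (leq_ltn_trans (ltnW D_ge2) lt_Dn).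

Lemma broom_simple : simple_graph (broom_rel n D).
Proof.
split=> [x y|x]; rewrite /broom_rel; last by apply/negbTE; lia.
by apply/idP/idP; lia.
Qed.

Lemma broom_connected_dist :
  connected_graph (broom_rel n D) /\ forall v, dist (broom_rel n D) v0 v = minn v D.
Proof.
apply: (@dist_potential _ _ v0 (fun v : 'I_n => minn v D)).
- exact: (proj1 broom_simple).
- by rewrite min0n.
- by move=> x y; rewrite /broom_rel; lia.
- move=> x; rewrite -val_eqE /= => x_gt0.
  have lt_xn := ltn_ord x.
  (* The neighbour nearer to [v0] is the predecessor of [x] on the path, and [D - 1] for the
     vertices beyond [D]. *)
  have lt_yn : (minn x.-1 D.-1 < n)%N by lia.
  by exists (Ordinal lt_yn); rewrite ?/broom_rel /=; lia.
Qed.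

(** Since [D >= 2], the pendant vertices hang from [D - 1 >= 1] and not from [v0]. *)
Lemma broom_leaf (v : 'I_n) : broom_rel n D v0 v -> v = v1.
Proof. by move=> v0_v; apply: val_inj; move: v0_v; rewrite /broom_rel /=; lia. Qed.

Lemma sum_broom_dist (R : realFieldType) (g : nat -> R) :
  \sum_(v | v != v0) g (dist (broom_rel n D) v0 v) = broom_sum g n D.
Proof.
under eq_bigr => v _ do rewrite (proj2 broom_connected_dist).
transitivity (\sum_(0 <= i < n | i != 0%N) g (minn i D)); first by rewrite big_mkord.
rewrite big_ltn_cond //= big_nat_cond.
transitivity (\sum_(1 <= i < n) g (minn i D)).
  by rewrite [RHS]big_nat_cond; apply: eq_bigl => i; lia.
have D_gt0 := ltnW D_ge2.
rewrite (big_cat_nat D_gt0 (ltnW lt_Dn)) /=; congr (_ + _).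
  by rewrite !big_nat; apply: eq_bigr => i /andP[_ lt_iD]; congr g; lia.
rewrite mulr_natl -(sumr_const_nat n) !big_nat.
by apply: eq_bigr => i /andP[le_Di _]; congr g; lia.
Qed.

Lemma networkness_broom (R : realFieldType) (lam : R) : 0 < lam -> lam < 1 ->
  networkness (broom_rel n D) lam v0 = broom_val lam n D.
Proof.
move=> lam_gt0 lam_lt1; have [e_conn _] := broom_connected_dist.
rewrite broom_valE ?lt_Dn ?(ltnW D_ge2) //.
rewrite /networkness (c_e_leaf lam_gt0 broom_simple e_conn broom_leaf) /t_e.
by rewrite -!sum_broom_dist.
Qed.

End Broom.

Theorem theorem9 (R : realFieldType) (lam : R) (hlam0 : 0 < lam) (hlam1 : lam < 1) :
  (forall (T : finType) (e : rel T) (u0 : T),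
      simple_graph e -> connected_graph e -> (3 <= #|T|)%N ->
      lower_bound lam #|T| <= min_networkness e lam u0 /\
      min_networkness e lam u0 <= 1)
  /\
  (forall n : nat, (3 <= n)%N ->
      exists D : nat, [/\ (2 <= D)%N, (D <= n - 1)%N &
        forall hn : (0 < n)%N,
          let v0 := Ordinal hn in
          networkness (broom_rel n D) lam v0 = lower_bound lam n /\
          min_networkness (broom_rel n D) lam v0 = lower_bound lam n])
  /\
  (forall (T : finType) (e : rel T) (u0 : T),
      simple_graph e -> connected_graph e -> (3 <= #|T|)%N ->
      vertex_transitive e -> min_networkness e lam u0 = 1).
Proof.
split; last split.
- move=> T e u0 e_graph e_conn card_T; split.
    exact: lower_bound_le_min_networkness.
  by apply: min_networkness_le1; rewrite // ltnW.
- move=> n n_ge3; have [D /andP[D_ge2 lt_Dn] eq_D] := lower_bound_attained lam n_ge3.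
  exists D; split=> [//||n_gt0 v0]; first by lia.
  have N_v0 : networkness (broom_rel n D) lam v0 = lower_bound lam n.
    by rewrite eq_D networkness_broom.
  (* The minimum is at most the value at [v0]; the general lower bound, applied to the broom, gives
     the other inequality. *)
  split=> //; apply/eqP; rewrite eq_le -{1}N_v0 bigmin_le /=.
  have [e_conn _] := broom_connected_dist D_ge2 lt_Dn n_gt0.
  rewrite -{1}(card_ord n); apply: lower_bound_le_min_networkness => //.
    exact: broom_simple.
  by rewrite card_ord.
- move=> T e u0 e_graph e_conn card_T trans_e.
  apply: min_networkness_const => u.
  by apply: vertex_transitive_networkness; rewrite // ltnW.
Qed.
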